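(* Let $X$ be a random variable having one of the following four laws, with mean $\mu$ and variance $\sigma^2$: (1) binomial $\mathrm{Bin}(N,p)$, $N\ge 1$ an integer, $0<p<1$; (2) Poisson $\mathrm{Poi}(\lambda)$, $\lambda>0$ real; (3) negative binomial $\mathrm{NB}(r,p)$, $r>0$ real, $0<p<1$; (4) hypergeometric $\mathrm{Hyp}(N,K,n)$ with integers $1\le K\le N-1$, $1\le n\le N-1$. Let $\nu=\lceil\mu\rceil$, and let $P^{\downarrow}$ denote the mass function of, respectively, $$\mathrm{Bin}(N-1,p),\qquad \mathrm{Poi}(\lambda),\qquad \mathrm{NB}(r+1,p),\qquad \mathrm{Hyp}(N-2,K-1,n-1).$$ Then in each case $$\mathbb E|X-\mu|=2\,\sigma^2\,P^{\downarrow}\{\nu-1\}.$$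
   Context: Conventions for the laws, with $q=1-p$. Binomial: $\Pr\{X=k\}=\binom Nk p^kq^{N-k}$, $\mu=Np$, $\sigma^2=Npq$. Poisson: $\Pr\{X=k\}=e^{-\lambda}\lambda^k/k!$, $\mu=\sigma^2=\lambda$. Negative binomial (counting failures, $r>0$ real): $\Pr\{X=k\}=\binom{k+r-1}{k}p^rq^k=\frac{\Gamma(k+r)}{\Gamma(r)\Gamma(k+1)}p^rq^k$ for integers $k\ge0$, $\mu=rq/p$, $\sigma^2=rq/p^2$. Hypergeometric: $\Pr\{X=k\}=\binom Kk\binom{N-K}{n-k}/\binom Nn$, with $\binom{m}{j}=0$ for $j<0$ or $j>m$, $\mu=nK/N$, $\sigma^2=\frac{nK(N-K)(N-n)}{N^2(N-1)}$. The same mass-function formulas define $P^{\downarrow}$ with the shifted parameters, including the degenerate laws $\mathrm{Bin}(0,p)$ and $\mathrm{Hyp}(0,0,0)$ (point masses at $0$). *)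

(* Defs.v *)
From mathcomp Require Import all_boot all_order all_algebra.
From mathcomp Require Import all_classical all_reals all_analysis.

Set Implicit Arguments.
Unset Strict Implicit.
Unset Printing Implicit Defensive.

Import Order.TTheory GRing.Theory Num.Theory.

Local Open Scope ring_scope.

(* The binomial coefficient with a real upper argument,
   x (x - 1) ... (x - k + 1) / k! *)
Definition gbinom (R : realType) (x : R) (k : nat) : R :=
  (\prod_(i < k) (x - i%:R)) / k`!%:R.

(* The binomial coefficient with an integer lower argument, 0 when j < 0:
   in the hypergeometric law 'C(N - K, n - k) must vanish for k > n, which
   truncated subtraction on nat would not give. *)
Definition binz (m : nat) (j : int) : nat :=
  if j is Posz j' then 'C(m, j') else 0%N.

Inductive law (R : realType) : Type :=
| Bin of nat & R            (* Bin N p *)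
| Poi of R                  (* Poi lambda *)
| NB of R & R               (* NB r p *)
| Hyp of nat & nat & nat.   (* Hyp N K n *)

Arguments Hyp {R}.

Definition admissible (R : realType) (L : law R) : Prop :=
  match L with
  | Bin N p => (1 <= N)%N /\ 0 < p < 1
  | Poi lambda => 0 < lambda
  | NB r p => 0 < r /\ 0 < p < 1
  | Hyp N K n => (1 <= K <= N - 1)%N /\ (1 <= n <= N - 1)%N
  end.

Definition law_pmf (R : realType) (L : law R) (k : int) : R :=
  if k is Posz j then
    match L with
    | Bin N p => binomial_pmf N p j
    | Poi lambda => poisson_pmf lambda j
    | NB r p => gbinom (j%:R + r - 1) j * p `^ r * (1 - p) ^+ j
    | Hyp N K n =>
        (binz K j%:Z)%:R * (binz (N - K) (n%:Z - j%:Z))%:R / 'C(N, n)%:R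
    end
  else 0.

Definition law_mean (R : realType) (L : law R) : R :=
  match L with
  | Bin N p => N%:R * p
  | Poi lambda => lambda
  | NB r p => r * (1 - p) / p
  | Hyp N K n => n%:R * K%:R / N%:R
  end.

Definition law_var (R : realType) (L : law R) : R :=
  match L with
  | Bin N p => N%:R * p * (1 - p)
  | Poi lambda => lambda
  | NB r p => r * (1 - p) / p ^+ 2
  | Hyp N K n =>
      n%:R * K%:R * (N%:R - K%:R) * (N%:R - n%:R) / (N%:R ^+ 2 * (N%:R - 1))
  end.

Definition law_down (R : realType) (L : law R) : law R :=
  match L with
  | Bin N p => Bin (N - 1) p
  | Poi lambda => Poi lambda
  | NB r p => NB (r + 1) p
  | Hyp N K n => Hyp (N - 2) (K - 1) (n - 1)
  end.

(* For admissible L the masses sum to 1, so this determines the law of X. *)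
Definition has_law (R : realType) (d : measure_display) (T : measurableType d)
    (P : probability T R) (X : {RV P >-> R}) (L : law R) : Prop :=
  forall k : int, pmf X k%:~R = law_pmf L k.

(* Main.v *)
(* For each law, with p its mass function and D k = Pdown {k - 1}, one has
   (k - mu) p(k) = sigma2 (D k - D (k + 1)), D 0 = 0 and D k -> 0.  Summing over
   all k gives E X = mu; splitting the sum of |k - mu| p(k) at k = ceil mu, both
   halves telescope to sigma2 D (ceil mu).  Multiplying by k - mu and summing by
   parts turns the variance into sigma2 times the total mass of Pdown, which
   is 1.  The total masses also show that X is almost surely a natural number,
   so that expectations are series. *)
Require Import Defs.
From mathcomp Require Import all_boot all_order all_algebra.
From mathcomp Require Import all_classical all_reals all_analysis.
From mathcomp Require Import measurable_realfun zify ring lra.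

Set Implicit Arguments.
Unset Strict Implicit.
Unset Printing Implicit Defensive.

Import Order.TTheory GRing.Theory Num.Theory.
Import numFieldNormedType.Exports.

Local Open Scope classical_set_scope.
Local Open Scope ring_scope.

(** * Series satisfying a Stein identity *)

Section SteinSeries.
Variables (R : realType) (p D : R ^nat) (mu s : R).
Hypothesis stein : forall k, (k%:R - mu) * p k = s * (D k - D k.+1).
Hypothesis D0 : D 0 = 0.

Lemma series_centered n : series (fun k => (k%:R - mu) * p k) n = - s * D n.
Proof.
elim: n => [|n IHn]; first by rewrite /series /= big_nil D0 mulr0.
by rewrite seriesSr IHn stein; ring.
Qed.

(** Since [series_centered] telescopes, the n-th partial sum is mu times the partial mass minus
    [s * D n]. Convergence of the first moment is thus a conclusion, not an assumption. *)
Lemma cvg_series_mean :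
  series p @ \oo --> (1 : R) -> D @ \oo --> (0 : R) ->
  series (fun k => k%:R * p k) @ \oo --> mu.
Proof.
move=> p1 Dc.
have -> : series (fun k => k%:R * p k) = (fun n => mu * series p n - s * D n).
  apply/funext => n; rewrite -mulNr -series_centered /series /= mulr_sumr -big_split /=.
  by apply: eq_bigr => k _; ring.
rewrite -[X in _ --> X](_ : mu * 1 - s * 0 = mu); last by ring.
by apply: cvgB; apply: cvgMr.
Qed.

(** One factor k - mu is absorbed by the Stein identity and the other is summed by parts. The
    boundary term is (n - mu - 1) D n, which is why n D n -> 0 is required. *)
Lemma cvg_series_variance :
  series D @ \oo --> (1 : R) -> (fun n => n%:R * D n) @ \oo --> (0 : R) ->
  D @ \oo --> (0 : R) ->
  series (fun k => (k%:R - mu) ^+ 2 * p k) @ \oo --> s.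
Proof.
move=> D1 nD Dc.
(* summation by parts *)
have -> : series (fun k => (k%:R - mu) ^+ 2 * p k)
    = (fun n => s * (series D n - (n%:R * D n - (mu + 1) * D n))).
  apply/funext; elim=> [|n IHn].
    by rewrite /series /= !big_nil D0; ring.
  rewrite !seriesSr IHn expr2 -mulrA stein -natr1; ring.
rewrite -[X in _ --> X](_ : s * (1 - (0 - (mu + 1) * 0)) = s); last by ring.
by apply: cvgMr; apply: cvgB => //; apply: cvgB => //; apply: cvgMr.
Qed.

Lemma cvg_series_mad m :
  (forall k, (k < m)%N -> k%:R <= mu) -> (forall k, (m <= k)%N -> mu <= k%:R) ->
  D @ \oo --> (0 : R) ->
  series (fun k => `|k%:R - mu| * p k) @ \oo --> 2 * s * D m.
Proof.
(* [s * E n] is the n-th partial sum. Up to [m] the differences enter with reversed sign and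
   telescope to [D n]; beyond [m] they add [D m - D n] to the value [D m] reached there. *)
move=> ltm gem Dc; pose E k := if (k <= m)%N then D k else 2 * D m - D k.
have serE n : series (fun k => `|k%:R - mu| * p k) n = s * E n.
  elim: n => [|n IHn]; first by rewrite /series /= big_nil /E D0 mulr0.
  rewrite seriesSr IHn /E; case: (ltngtP n m) => [nm|mn|->].
  - by rewrite distrC ger0_norm ?subr_ge0 ?ltm// -opprB mulNr stein; ring.
  - by rewrite ger0_norm ?subr_ge0 ?gem 1?ltnW// stein; ring.
  - by rewrite ger0_norm ?subr_ge0 ?gem// stein; ring.
rewrite (funext serE) -[X in _ --> X](_ : s * (2 * D m - 0) = 2 * s * D m); last by ring.
apply: cvgMr; apply: (@cvg_trans _ ((fun k => 2 * D m - D k) @ \oo)); last first.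
  by apply: cvgB => //; exact: cvg_cst.
apply: near_eq_cvg; exists m.+1 => // k /= mk.
by rewrite /E leqNgt mk.
Qed.

End SteinSeries.

(** * Expectations of natural-valued variables *)

Section NatSupported.
Variables (R : realType) (d : measure_display) (T : measurableType d).
Variables (P : probability T R) (X : {RV P >-> R}).
Hypothesis pmf1 : series (fun k => pmf X k%:R) @ \oo --> (1 : R).

Let A (k : nat) := X @^-1` [set k%:R].

Let mA k : measurable (A k).
Proof. exact: measurable_funPTI. Qed.

Let tA : trivIset setT A.
Proof.
move=> i j _ _ [w []]; rewrite /A /= => Xi Xj; apply/eqP.
by rewrite -(eqr_nat R) -Xi -Xj.
Qed.

Let PA k : P (A k) = (pmf X k%:R)%:E.
Proof. by rewrite /pmf fineK// fin_num_measure. Qed.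

Let lim_eseries (u : R ^nat) (l : R) : series u @ \oo --> l ->
  (\sum_(k <oo) (u k)%:E)%E = l%:E.
Proof.
move=> ul; apply/cvg_lim => //.
rewrite (_ : (fun n => _) = EFin \o series u); last first.
  by apply/funext => n; rewrite /= sumEFin.
by apply: cvg_EFin => //; exact: nearW.
Qed.

Let Abar := \bigcup_k A k.

Let mAbar : measurable Abar.
Proof. exact: bigcupT_measurable. Qed.

(** The fibres [A k] are disjoint and, by [pmf1], exhaust the total mass 1. *)
Let null : P (~` Abar) = 0%E.
Proof.
rewrite probability_setC//.
rewrite measure_bigcup//.
rewrite (eq_eseriesr (g := fun k => (pmf X k%:R)%:E)); last by move=> k _; exact: PA.
rewrite (eq_eseriesl (Q := xpredT)); last by move=> k; rewrite in_setT.
by rewrite (lim_eseries pmf1) subee.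
Qed.

Lemma ae_nat_supported : {ae P, forall w, exists k : nat, X w = k%:R}.
Proof.
exists (~` Abar); split => //; first exact: measurableC.
by move=> w /= nw [k _ /= Xw]; apply: nw; exists k.
Qed.

(** Nonnegativity of f allows the integral to be split over the countably many fibres of X without
    knowing integrability beforehand. *)
Lemma expectation_nat_supported (f : R -> R) (l : R) :
  measurable_fun setT f -> (forall x, 0 <= f x) ->
  series (fun k => f k%:R * pmf X k%:R) @ \oo --> l ->
  'E_P[fun w => f (X w)]%E = l%:E.
Proof.
move=> mf f0 fl; rewrite unlock.
have mfX : measurable_fun setT (EFin \o (f \o X)).
  by apply/measurable_EFinP; exact: measurableT_comp.
rewrite (@ge0_negligible_integral _ _ _ _ _ (~` Abar))//; last first.
- by move=> w _; rewrite lee_fin.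
- exact: measurableC.
rewrite setDE setCK setTI ge0_integral_bigcup//; last first.
- by move=> w _; rewrite lee_fin.
- exact: measurable_funS mfX.
rewrite -(lim_eseries fl); apply: eq_eseriesr => k _.
transitivity (\int[P]_(w in A k) (f k%:R)%:E)%E.
  by apply: eq_integral => w; rewrite inE /A /= => ->.
rewrite integral_cst// EFinM; congr (_ * _)%E; exact: PA.
Qed.

Lemma expectation_nat_supported_id (l : R) :
  series (fun k => k%:R * pmf X k%:R) @ \oo --> l ->
  'E_P[X]%E = l%:E.
Proof.
move=> Xl.
(* X is nonnegative only almost surely, so the nonnegative case is applied to |X|, which agrees with
   X almost surely. *)
have <- : 'E_P[fun w => `|X w|%R]%E = l%:E.
  apply: expectation_nat_supported => //.
  rewrite [X in series X](_ : _ = (fun k => k%:R * pmf X k%:R))//.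
  by apply/funext => k; rewrite normr_nat.
rewrite unlock; apply: ae_eq_integral => //.
- exact/measurable_EFinP.
- by apply/measurable_EFinP; exact: measurableT_comp.
apply: filterS ae_nat_supported => w [k Xw] _.
by rewrite Xw normr_nat.
Qed.

End NatSupported.

(** * Convergence criteria: ratio test and finite support *)

Section Ratio.
Variable R : realType.

Lemma cvg_ratio0 (u : R ^nat) (s : R) (N : nat) :
  (forall n, 0 <= u n) -> 0 <= s < 1 ->
  (forall n, (N <= n)%N -> u n.+1 <= s * u n) -> u @ \oo --> (0 : R).
Proof.
move=> u0 /andP[s0 s1] us; rewrite -(cvg_shiftn N).
have bnd n : u (n + N)%N <= geometric (u N) s n.
  elim: n => [|n IHn]; first by rewrite /= mulr1.
  rewrite addSn (le_trans (us _ _)) ?leq_addl//= exprS mulrCA.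
  exact: ler_wpM2l.
apply: (@squeeze_cvgr _ _ _ _ (cst 0) (geometric (u N) s)).
- by apply: nearW => n; rewrite u0 bnd.
- exact: cvg_cst.
- by apply: cvg_geometric; rewrite ger0_norm.
Qed.

Lemma cvg_series_finite (u : R ^nat) (M : nat) (l : R) :
  (forall k, (M <= k)%N -> u k = 0) -> series u M = l -> series u @ \oo --> l.
Proof.
move=> u0 <-; apply: cvg_near_cst; exists M => // n /= Mn.
apply/eqP; rewrite -subr_eq0 sub_series_geq// big_nat_cond big1// => i.
by move=> /andP[/andP[/u0]].
Qed.

End Ratio.

(** * The negative binomial series *)

Section Rising.
Variable R : realType.
Implicit Types (r : R) (k n : nat).

(* 'C(k + r - 1, k) for real r *)
Definition rising r k : R := (\prod_(i < k) (r + i%:R)) / k`!%:R.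

Lemma gbinom_rising r k : gbinom (k%:R + r - 1) k = rising r k.
Proof.
rewrite /gbinom /rising; congr (_ / _).
rewrite (reindex_inj rev_ord_inj) /=; apply: eq_bigr => i _.
by rewrite natrB// -natr1; ring.
Qed.

Lemma rising0 r : rising r 0 = 1.
Proof. by rewrite /rising big_ord0 fact0 divr1. Qed.

Lemma risingSr r k : k.+1%:R * rising r k.+1 = (r + k%:R) * rising r k.
Proof.
rewrite /rising big_ord_recr /= factS natrM.
have k0 : k.+1%:R != 0 :> R by rewrite pnatr_eq0.
have f0 : k`!%:R != 0 :> R by rewrite pnatr_eq0 -lt0n fact_gt0.
by field; rewrite f0 nat1r k0.
Qed.

Lemma risingSl r k : k.+1%:R * rising r k.+1 = r * rising (r + 1) k.
Proof.
rewrite /rising big_ord_recl /= addr0 factS natrM.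
rewrite (eq_bigr (fun i : 'I_k => r + 1 + i%:R)); last first.
  by move=> i _; rewrite /bump /= -natr1; ring.
have k0 : k.+1%:R != 0 :> R by rewrite pnatr_eq0.
have f0 : k`!%:R != 0 :> R by rewrite pnatr_eq0 -lt0n fact_gt0.
by field; rewrite f0 nat1r k0.
Qed.

Lemma rising_ge0 r k : 0 <= r -> 0 <= rising r k.
Proof. by move=> r0; rewrite divr_ge0// prodr_ge0// => i _; rewrite addr_ge0. Qed.

(** Ratio test: consecutive terms have quotient (r + n + 1) q / (n + 1), which tends to q < 1. This
    sequence controls the derivative in [is_derive_nb_partial]. *)
Lemma cvg_rising_geometric0 r (q : R) : 0 < r -> 0 < q < 1 ->
  (fun n => (r + n%:R) * rising r n * q ^+ n) @ \oo --> (0 : R).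
Proof.
move=> r0 /andP[q0 q1].
(* s is the midpoint of q and 1. The quotient is at most s exactly when 2 q r <= (n + 1) (1 - q),
   and N is chosen to ensure this. *)
pose s := (1 + q) / 2; pose N := Num.truncn (2 * q * r / (1 - q)).
apply: (@cvg_ratio0 _ _ s N).
- move=> n; rewrite mulr_ge0 ?exprn_ge0 ?(ltW q0)// mulr_ge0 ?rising_ge0 ?(ltW r0)//.
  by rewrite addr_ge0 ?(ltW r0).
- by rewrite /s; apply/andP; split; lra.
move=> n Nn.
have nq : 2 * q * r <= n.+1%:R * (1 - q).
  rewrite -ler_pdivrMr ?subr_gt0// (le_trans (ltW (truncnS_gt _)))//.
  by rewrite ler_nat ltnS.
set w := rising r n * q ^+ n.
have w0 : 0 <= w by rewrite mulr_ge0 ?exprn_ge0 ?(ltW q0)// rising_ge0// ltW.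
have n0 : 0 < n.+1%:R :> R by rewrite ltr0n.
have rn : 0 <= r + n%:R by rewrite addr_ge0 ?(ltW r0).
rewrite (_ : rising r n.+1 = (r + n%:R) * rising r n / n.+1%:R); last first.
  by rewrite -risingSr mulrC mulKf// gt_eqF.
rewrite (_ : (_ * _) * q ^+ n.+1
    = (r + n.+1%:R) * q / n.+1%:R * ((r + n%:R) * w)); last first.
  by rewrite /w exprS; ring.
rewrite (_ : s * _ = s * ((r + n%:R) * w)); last by rewrite /w; ring.
apply: ler_wpM2r; first exact: mulr_ge0.
rewrite ler_pdivrMr// /s; lra.
Qed.

(* The derivative telescopes to one term because
   (j + 1) rising r (j + 1) = (r + j) rising r j. *)
Lemma is_derive_nb_partial r n (t : R) : t < 1 ->
  is_derive t 1
    (fun x => (1 - x) `^ r * series (fun j => rising r j * x ^+ j) n.+1)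
    (- ((r + n%:R) * rising r n * t ^+ n * (1 - t) `^ (r - 1))).
Proof.
move=> t1.
have t0 : 0 < 1 - t by rewrite subr_gt0.
have dpow : is_derive t 1 (fun x => (1 - x) `^ r) (- (r * (1 - t) `^ (r - 1))).
  have d1 : is_derive t 1 (fun x : R => 1 - x) (-1).
    by rewrite -[X in is_derive _ _ _ X]add0r; apply: is_deriveB.
  have := @is_derive1_comp R (@powR R ^~ r) (fun x : R => 1 - x) t _ _
    (is_derive1_powR r t0) d1.
  by rewrite mulrN1.
have powS : (1 - t) `^ r = (1 - t) * (1 - t) `^ (r - 1).
  rewrite powRB; last by rewrite (gt_eqF t0) implybT.
  by rewrite powRr1 ?ltW// mulrCA mulfV ?mulr1// gt_eqF.
elim: n => [|n IHn].
  rewrite (_ : (fun x => _) = (fun x => (1 - x) `^ r)); last first.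
    apply/funext => x; rewrite /series /= big_nat1 rising0 expr0; ring.
  by rewrite rising0 expr0 addr0 !mulr1.
rewrite (_ : (fun x => _) =
  (fun x => (1 - x) `^ r * series (fun j => rising r j * x ^+ j) n.+1) +
  (fun x => (1 - x) `^ r) * (rising r n.+1 *: (id : R -> R) ^+ n.+1)); last first.
  by apply/funext => x; rewrite seriesSr mulrDr !fctE.
apply: is_derive_eq.
have rS := risingSr r n.
rewrite /= !fctE powS /GRing.scale /= exprS -rS.
have -> : (r + n.+1%:R) * rising r n.+1 = r * rising r n.+1 + n.+1%:R * rising r n.+1 by ring.
ring.
Qed.

(** This is the binomial series for (1 - q)^(-r). The product [S n] of (1 - x)^r with a partial sum
    equals 1 at x = 0, and its derivative on [0, q] tends to 0 uniformly, so [S n q] tends to 1. *)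
Lemma cvg_nb_series r (p : R) : 0 < r -> 0 < p < 1 ->
  series (fun j => rising r j * p `^ r * (1 - p) ^+ j) @ \oo --> (1 : R).
Proof.
move=> r0 /andP[p0 p1]; set q := 1 - p.
have [q0 q1] : 0 < q /\ q < 1 by rewrite /q; split; lra.
have pE : p = 1 - q by rewrite /q; ring.
pose S n x := (1 - x) `^ r * series (fun j => rising r j * x ^+ j) n.+1 : R.
pose u n := (r + n%:R) * rising r n * q ^+ n.
have u0 n : 0 <= u n.
  rewrite mulr_ge0 ?exprn_ge0 ?(ltW q0)// mulr_ge0 ?rising_ge0 ?(ltW r0)//.
  by rewrite addr_ge0 ?(ltW r0).
have bnd n : `|S n q - 1| <= u n / p.
  have := @MVT_segment R (S n)
    (fun t => - ((r + n%:R) * rising r n * t ^+ n * (1 - t) `^ (r - 1))) 0 q.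
  case; first exact: ltW.
  - move=> t; rewrite in_itv/= => /andP[_ tq].
    by apply: is_derive_nb_partial; exact: lt_trans tq q1.
  - apply: derivable_within_continuous => t; rewrite in_itv/= => /andP[_ tq].
    by have [] := is_derive_nb_partial r n (le_lt_trans tq q1).
  move=> c; rewrite in_itv/= => /andP[c0 cq].
  have -> : S n 0 = 1.
    rewrite /S subr0 powR1 mul1r seriesEnat /= big_nat_recl//.
    rewrite rising0 expr0 mulr1 big1 ?addr0// => j _.
    by rewrite exprS mul0r mulr0.
  move=> ->; rewrite subr0 mulNr normrN.
  have c1 : 0 < 1 - c by rewrite subr_gt0 (le_lt_trans cq).
  (* The exponent r - 1 may be negative. Writing the power as (1 - c)^r / (1 - c) treats all r > 0
     at once: the numerator is at most 1 and the denominator at least p. *)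
  have pc : (1 - c) `^ (r - 1) <= p^-1.
    rewrite powRB; last by rewrite (gt_eqF c1) implybT.
    rewrite powRr1 ?(ltW c1)// -[leRHS]mul1r ler_pM ?powR_ge0 ?invr_ge0 ?(ltW c1)//.
      rewrite [leRHS](_ : 1 = 1 `^ r); last by rewrite powR1.
      apply: ge0_ler_powR; rewrite ?nnegrE ?(ltW r0) ?(ltW c1) ?ler01//. lra.
    by rewrite lef_pV2 ?posrE// pE lerD2l lerN2.
  have rn : 0 <= (r + n%:R) * rising r n by rewrite mulr_ge0 ?rising_ge0 ?addr_ge0 ?(ltW r0).
  rewrite ger0_norm; last first.
    by rewrite mulr_ge0 ?(ltW q0)// mulr_ge0 ?powR_ge0// mulr_ge0// exprn_ge0.
  rewrite -[leRHS]mulr1; apply: ler_pM => //; rewrite ?(ltW q0) ?(ltW q1)//.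
    by rewrite mulr_ge0 ?powR_ge0// mulr_ge0// exprn_ge0.
  apply: ler_pM pc; [by rewrite mulr_ge0// exprn_ge0 | exact: powR_ge0 |].
  by rewrite /u ler_wpM2l// lerXn2r ?nnegrE// ltW.
have Sc : S ^~ q @ \oo --> (1 : R).
  have uc : (fun n => u n / p) @ \oo --> (0 : R).
    rewrite -[X in _ --> X](mul0r p^-1); apply: cvgMl.
    by apply: cvg_rising_geometric0; rewrite ?q0.
  apply: (@squeeze_cvgr _ _ _ _ (fun n => 1 - u n / p) (fun n => 1 + u n / p)).
  - by apply: nearW => n; rewrite -ler_distl bnd.
  - by rewrite -[X in _ --> X]subr0; apply: cvgB => //; exact: cvg_cst.
  - by rewrite -[X in _ --> X]addr0; apply: cvgD => //; exact: cvg_cst.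
rewrite -(cvg_shiftS _ _).
rewrite (_ : (fun n => _) = S ^~ q)//; apply/funext => n.
by rewrite /S -pE /series /= mulr_sumr; apply: eq_bigr => j _; ring.
Qed.

End Rising.

(** * The four laws *)

Section Laws.
Variable R : realType.
Implicit Types (L : law R) (j k n m N K : nat) (p r lambda : R).

Lemma cvg_natr_finite (u : R ^nat) N :
  (forall k, (N < k)%N -> u k = 0) -> (fun k => k%:R * u k) @ \oo --> (0 : R).
Proof.
by move=> u0; apply: cvg_near_cst; exists N.+1 => // k /= /u0 ->; rewrite mulr0.
Qed.

(** * Binomial law *)

Lemma law_pmf_Bin_eq0 N p k : (N < k)%N -> law_pmf (Bin N p) k = 0.
Proof. by move=> Nk; rewrite /= /binomial_pmf bin_small ?mulr0n. Qed.

Lemma Bin_total N p : series (fun k : nat => law_pmf (Bin N p) k) @ \oo --> (1 : R).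
Proof.
apply: (@cvg_series_finite _ _ N.+1) => [k|]; first exact: law_pmf_Bin_eq0.
rewrite seriesEord /= -[RHS](expr1n _ N) -[X in _ = X ^+ _](subrK p 1) exprDn.
by apply: eq_bigr => k _; rewrite /binomial_pmf mulrC.
Qed.

Lemma binomial_pmfE N p k :
  binomial_pmf N p k = p ^+ k * (1 - p) ^+ (N - k) * 'C(N, k)%:R.
Proof. by rewrite /binomial_pmf mulr_natr. Qed.

Lemma mul_binomial_pmfS N p k :
  k.+1%:R * binomial_pmf N.+1 p k.+1 = N.+1%:R * p * binomial_pmf N p k.
Proof.
have := congr1 (fun n => n%:R : R) (mul_bin_diag N.+1 k); rewrite /= !natrM => e.
rewrite !binomial_pmfE subSS exprS.
transitivity (p * p ^+ k * (1 - p) ^+ (N - k) * (k.+1%:R * 'C(N.+1, k.+1)%:R)); first ring.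
rewrite -e; ring.
Qed.

Lemma mul_binomial_pmf_sub N p k :
  (N.+1%:R - k%:R) * binomial_pmf N.+1 p k = N.+1%:R * (1 - p) * binomial_pmf N p k.
Proof.
(* For k > N both sides vanish: at k = N + 1 because of the factor N + 1 - k, beyond that because
   the binomial coefficient is 0. *)
have [kN|Nk] := leqP k N; last first.
  rewrite [in RHS]/binomial_pmf bin_small// mulr0n mulr0.
  move: Nk; rewrite leq_eqVlt => /orP[/eqP <-|Nk]; first by rewrite subrr mul0r.
  by rewrite /binomial_pmf bin_small ?mulr0n ?mulr0.
have := congr1 (fun n => n%:R : R) (mul_bin_down N.+1 k).
rewrite /= !natrM (natrB _ (leqW kN)) => e.
rewrite !binomial_pmfE subSn// exprS.
transitivity (p ^+ k * ((1 - p) * (1 - p) ^+ (N - k)) *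
  ((N.+1%:R - k%:R) * 'C(N.+1, k)%:R)); first ring.
rewrite -e; ring.
Qed.

(** * Poisson law *)

Lemma Poi_total lambda : 0 < lambda ->
  series (fun k : nat => law_pmf (Poi lambda) k) @ \oo --> (1 : R).
Proof.
move=> l0; rewrite (_ : series _ = (fun n => expR (- lambda) * series (exp_coeff lambda) n)).
  have e0 : expR lambda != 0 by rewrite gt_eqF// expR_gt0.
  rewrite -[X in _ --> X](mulVf e0) -expRN.
  by apply: cvgMr; exact: is_cvg_series_exp_coeff.
apply/funext => n; rewrite /series /= mulr_sumr; apply: eq_bigr => k _.
by rewrite /poisson_pmf l0 /exp_coeff /= mulrC.
Qed.

Lemma mul_Poi_pmfS lambda k : 0 < lambda ->
  k.+1%:R * law_pmf (Poi lambda) k.+1 = lambda * law_pmf (Poi lambda) k.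
Proof.
move=> l0; rewrite /= /poisson_pmf l0 factS natrM exprS.
have k0 : k.+1%:R != 0 :> R by rewrite pnatr_eq0.
have f0 : k`!%:R != 0 :> R by rewrite pnatr_eq0 -lt0n fact_gt0.
by field; rewrite f0 nat1r k0.
Qed.

(** * Negative binomial law *)

Lemma law_pmf_NBE r p k : law_pmf (NB r p) k = rising r k * p `^ r * (1 - p) ^+ k.
Proof. by rewrite /= gbinom_rising. Qed.

Lemma NB_total r p : 0 < r -> 0 < p < 1 ->
  series (fun k : nat => law_pmf (NB r p) k) @ \oo --> (1 : R).
Proof.
move=> r0 p01; rewrite (funext (law_pmf_NBE r p)); exact: cvg_nb_series.
Qed.

Lemma powR_succ p r : 0 < p -> p `^ (r + 1) = p * p `^ r.
Proof.
move=> p0; rewrite powRD; last by rewrite (gt_eqF p0) implybT.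
by rewrite powRr1 ?ltW// mulrC.
Qed.

Lemma mul_NB_pmfS r p k : 0 < p ->
  k.+1%:R * law_pmf (NB r p) k.+1 = r * (1 - p) / p * law_pmf (NB (r + 1) p) k.
Proof.
move=> p0; rewrite !law_pmf_NBE powR_succ// exprS.
transitivity (k.+1%:R * rising r k.+1 * p `^ r * ((1 - p) * (1 - p) ^+ k)); first ring.
by rewrite risingSl; field; rewrite gt_eqF.
Qed.

Lemma mul_NB_pmf_add r p k : 0 < p ->
  (r + k%:R) * law_pmf (NB r p) k = r / p * law_pmf (NB (r + 1) p) k.
Proof.
move=> p0; rewrite !law_pmf_NBE powR_succ//.
transitivity ((r + k%:R) * rising r k * p `^ r * (1 - p) ^+ k); first ring.
by rewrite -risingSr risingSl; field; rewrite gt_eqF.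
Qed.

(** * Hypergeometric law *)

Lemma binzB m n j :
  binz m (n%:Z - j%:Z) = if (j <= n)%N then 'C(m, n - j) else 0%N.
Proof.
case: leqP => jn; first by rewrite subzn.
by rewrite -opprB subzn ?(ltnW jn)//; move: jn; rewrite -subn_gt0; case: (j - n)%N.
Qed.

(** Absorption over all integers; at z = -1 the factor z + 1 saves the identity. Together with
    [mul_binz_down] it spares [Hyp_stein] the boundary cases k = 0 and k > n. *)
Lemma mul_binz_diag m (z : int) :
  (z + 1)%:~R * (binz m.+1 (z + 1))%:R = m.+1%:R * (binz m z)%:R :> R.
Proof.
case: z => [j|[|j]].
- by rewrite (_ : Posz j + 1 = j.+1) -?[j.+1]addn1//= addn1 -!natrM -mul_bin_diag.
- by rewrite (_ : Negz 0 + 1 = 0)// mul0r mulr0.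
- by rewrite (_ : Negz j.+1 + 1 = Negz j) /= ?mulr0// !NegzE; lia.
Qed.

Lemma mul_binz_down m (z : int) :
  (m.+1%:R - z%:~R) * (binz m.+1 z)%:R = m.+1%:R * (binz m z)%:R :> R.
Proof.
case: z => [j|j] /=; last by rewrite !mulr0.
have [jm|mj] := leqP j m.+1.
  by rewrite -natrB// -!natrM mul_bin_down.
by rewrite !bin_small ?mulr0// ltnW.
Qed.

Lemma law_pmf_HypE N K n (z : int) : law_pmf (Hyp N K n) z =
  (binz K z)%:R * (binz (N - K) (n%:Z - z))%:R / 'C(N, n)%:R :> R.
Proof. by case: z => //= j; rewrite !mul0r. Qed.

Lemma law_pmf_Hyp_eq0 N K n k : (n < k)%N -> law_pmf (Hyp N K n) k = 0 :> R.
Proof. by move=> nk; rewrite /= binzB leqNgt nk mulr0 mul0r. Qed.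

Lemma Hyp_total N K n : (K <= N)%N -> (n <= N)%N ->
  series (fun k : nat => law_pmf (@Hyp R N K n) k) @ \oo --> (1 : R).
Proof.
move=> KN nN; apply: (@cvg_series_finite _ _ n.+1) => [k|]; first exact: law_pmf_Hyp_eq0.
have C0 : 'C(N, n)%:R != 0 :> R by rewrite pnatr_eq0 -lt0n bin_gt0.
rewrite seriesEord /= -mulr_suml.
apply: (canLR (mulfK C0)); rewrite mul1r -{2}(subnKC KN) -binomial.Vandermonde natr_sum.
by apply: eq_bigr => k _; rewrite natrM binzB -ltnS ltn_ord.
Qed.

(** The sequence D of the Stein identity; D 0 is the mass at -1, hence 0. *)
Definition law_down_shift L k : R := law_pmf (law_down L) (k%:Z - 1).

Lemma law_down_shiftS L k : law_down_shift L k.+1 = law_pmf (law_down L) k.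
Proof. by rewrite /law_down_shift -addn1 PoszD addrK. Qed.

(* Up to the factor N, the two terms of the right-hand side are
   k (N - K - n + k) p(k) and (K - k) (n - k) p(k), whose difference is
   (k N - n K) p(k). *)
Lemma Hyp_stein N K n k : (0 < K < N)%N -> (0 < n < N)%N ->
  (k%:R - law_mean (Hyp N K n)) * law_pmf (Hyp N K n) k =
  law_var (Hyp N K n) *
    (law_down_shift (Hyp N K n) k - law_down_shift (Hyp N K n) k.+1) :> R.
Proof.
(* With K = a + 1, n = b + 1, N = M + 2 and N - K = c + 1, the shifted law has parameters M, a, b,
   and truncated subtraction disappears. *)
case: K => // a; case: n => // b; case: N => [|[|M]] // aM bM.
have [c Mac] : exists c, M = (a + c)%N by exists (M - a)%N; lia.
rewrite /law_down_shift /law_down !law_pmf_HypE.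
rewrite [law_mean _]/= [law_var _]/= !subn2 !subn1 !succnK.
rewrite (_ : M.+2 - a.+1 = c.+1)%N; last lia.
rewrite (_ : M - a = c)%N; last lia.
rewrite (_ : k.+1%:Z - 1 = k%:Z); last lia.
pose z : int := k%:Z - 1.
have kz : k%:Z = z + 1 by rewrite subrK.
have kR : k%:R = (z + 1)%:~R :> R by rewrite -kz.
rewrite -/z kz kR.
(* Now z = k - 1 and y = n - 1 - k. Up to normalisation p(k) is C(a+1, z+1) C(c+1, y+1), D k is C(a,
   z) C(c, y+1), and D (k + 1) is C(a, z+1) C(c, y). *)
pose y : int := b%:Z - (z + 1).
rewrite (_ : b.+1%:Z - (z + 1) = y + 1); last by rewrite /y; lia.
rewrite (_ : b%:Z - z = y + 1); last by rewrite /y; lia.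
have ex1 := mul_binz_diag a z; have ex2 := mul_binz_down a (z + 1).
have ey1 := mul_binz_down c (y + 1); have ey2 := mul_binz_diag c y.
have yR : y%:~R = b%:R - (z + 1)%:~R :> R by rewrite /y !rmorphB.
have W0 : 'C(M.+2, b.+1)%:R != 0 :> R by rewrite pnatr_eq0 -lt0n bin_gt0 ltnW.
have V0 : 'C(M, b)%:R != 0 :> R by rewrite pnatr_eq0 -lt0n bin_gt0; lia.
(* Compares the normalisations: n (N - n) C(N, n) = N (N - 1) C(N - 2, n - 1). *)
have eW : b.+1%:R * (M.+2%:R - b.+1%:R) * 'C(M.+2, b.+1)%:R
    = M.+2%:R * M.+1%:R * 'C(M, b)%:R :> R.
  have := congr1 (fun n => n%:R : R) (mul_bin_diag M.+2 b).
  have := congr1 (fun n => n%:R : R) (mul_bin_down M.+1 b).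
  rewrite /= !natrM natrB; last lia.
  move=> e1 e2.
  transitivity ((M.+1%:R - b%:R) * (b.+1%:R * 'C(M.+2, b.+1)%:R) : R); first ring.
  rewrite -e2; transitivity (M.+2%:R * ((M.+1%:R - b%:R) * 'C(M.+1, b)%:R) : R); first ring.
  by rewrite -e1; ring.
rewrite -/y.
set x := (binz a.+1 (z + 1))%:R in ex1 ex2 *.
set x1 := (binz a z)%:R in ex1 *.
set x2 := (binz a (z + 1))%:R in ex2 *.
set w := (binz c.+1 (y + 1))%:R in ey1 ey2 *.
set w1 := (binz c (y + 1))%:R in ey1 *.
set w2 := (binz c y)%:R in ey2 *.
set W := 'C(M.+2, b.+1)%:R in eW W0 *.
set V := 'C(M, b)%:R in eW V0 *.
have yt : (y + 1)%:~R = b.+1%:R - (z + 1)%:~R :> R.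
  by rewrite rmorphD /= yR -natr1; ring.
have cN : c.+1%:R = M.+2%:R - a.+1%:R :> R.
  by rewrite -natrB; [congr (_%:R)|]; lia.
have a0 : a.+1%:R != 0 :> R by rewrite pnatr_eq0.
have c0 : c.+1%:R != 0 :> R by rewrite pnatr_eq0.
have M0 : M.+2%:R != 0 :> R by rewrite pnatr_eq0.
have M1 : M.+1%:R != 0 :> R by rewrite pnatr_eq0.
rewrite yt in ey1 ey2.
have -> : M.+2%:R - 1 = M.+1%:R :> R by rewrite -natr1 addrK.
have Vi : V^-1 = M.+2%:R * M.+1%:R / (b.+1%:R * (M.+2%:R - b.+1%:R) * W).
  rewrite eW invfM mulrA mulfV ?mul1r// mulf_neq0//.
have b0 : b.+1%:R * (M.+2%:R - b.+1%:R) != 0 :> R.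
  by apply: contraNneq V0 => e; move/eqP: eW; rewrite e mul0r eq_sym !mulf_eq0
    (negbTE M0) (negbTE M1).
have -> : x1 = (z + 1)%:~R * x / a.+1%:R by rewrite ex1 mulrC mulKf.
have -> : x2 = (a.+1%:R - (z + 1)%:~R) * x / a.+1%:R by rewrite ex2 mulrC mulKf.
have -> : w1 = (c.+1%:R - (b.+1%:R - (z + 1)%:~R)) * w / c.+1%:R by rewrite ey1 mulrC mulKf.
have -> : w2 = (b.+1%:R - (z + 1)%:~R) * w / c.+1%:R by rewrite ey2 mulrC mulKf.
rewrite -cN Vi.
(* All binomials are now multiples of [x], [w] and [W]; what remains is an identity of rational
   functions, with the naturals generalised to real variables. *)
move: b0 cN c0 a0 M0 M1 W0; clear.
move: (a.+1%:R : R) (b.+1%:R : R) (c.+1%:R : R) (M.+2%:R : R) (M.+1%:R : R)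
  ((z + 1)%:~R : R) => A B C N N1 t.
rewrite mulf_eq0 negb_or => /andP[B0 NB0] CE C0 A0 N0 N10 W0.
rewrite CE in C0 *.
by field; rewrite W0 NB0 B0 C0 A0 N10 N0.
Qed.

(** Outside the hypergeometric case, k - mu is split so that one part carries p(k) to D k and the
    other to D (k + 1). With q = 1 - p, the binomial split is q k - p (N - k), the Poisson one k -
    lambda, and the negative binomial one k / p - (q / p) (r + k). *)
Lemma law_stein L k : admissible L ->
  (k%:R - law_mean L) * law_pmf L k =
  law_var L * (law_down_shift L k - law_down_shift L k.+1).
Proof.
case: L => [N p|lambda|r p|N K n].
- move=> [N1 /andP[p0 p1]]; case: N N1 => // N _.
  rewrite law_down_shiftS /= subn1 /=.
  (* At k = 0 both the term q k and D 0 vanish, so only the other half of the split is left. *)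
  have := mul_binomial_pmf_sub N p k; case: k => [|k] e.
    rewrite /law_down_shift /= sub0r; move: e; rewrite subr0 => e.
    transitivity (- p * (N.+1%:R * binomial_pmf N.+1 p 0)); first ring.
    rewrite e; ring.
  rewrite law_down_shiftS /= subn1 /=.
  transitivity ((1 - p) * (k.+1%:R * binomial_pmf N.+1 p k.+1)
    - p * ((N.+1%:R - k.+1%:R) * binomial_pmf N.+1 p k.+1)); first ring.
  by rewrite e mul_binomial_pmfS; ring.
- move=> l0; rewrite law_down_shiftS; case: k => [|k].
    by rewrite /law_down_shift /= !sub0r mulrN mulNr.
  by rewrite law_down_shiftS mulrBl mulrBr mul_Poi_pmfS.
- move=> [r0 /andP[p0 p1]]; rewrite law_down_shiftS.
  have pn0 : p != 0 by rewrite gt_eqF.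
  have := mul_NB_pmf_add r k p0; case: k => [|k] e.
    rewrite /law_down_shift [law_pmf _ (0%:Z - 1)]/= !sub0r.
    move: e; rewrite addr0 => e.
    transitivity (- ((1 - p) / p) * (r * law_pmf (NB r p) 0%N)).
      by rewrite [law_mean _]/=; ring.
    by rewrite e [law_var _]/= [law_down _]/=; field.
  rewrite law_down_shiftS [law_var _]/= [law_mean _]/= [law_down _]/=.
  transitivity (k.+1%:R * law_pmf (NB r p) k.+1 / p
    - (1 - p) / p * ((r + k.+1%:R) * law_pmf (NB r p) k.+1)); first by field.
  by rewrite e mul_NB_pmfS//; field.
- by move=> [? ?]; apply: Hyp_stein; lia.
Qed.

(** * Total masses, decay and positive means for the four laws *)

Lemma law_total L : admissible L ->
  series (fun k : nat => law_pmf L k) @ \oo --> (1 : R).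
Proof.
case: L => [N p _|lambda|r p [r0 p01]|N K n [/andP[K1 KN] /andP[n1 nN]]].
- exact: Bin_total.
- exact: Poi_total.
- exact: NB_total.
- by apply: Hyp_total; [exact: leq_trans KN (leq_subr _ _)
                       |exact: leq_trans nN (leq_subr _ _)].
Qed.

Lemma law_down_total L : admissible L ->
  series (fun k : nat => law_pmf (law_down L) k) @ \oo --> (1 : R).
Proof.
case: L => [N p _|lambda|r p [r0 p01]|N K n [/andP[K1 KN] /andP[n1 nN]]].
- exact: Bin_total.
- exact: Poi_total.
- by apply: NB_total; rewrite // addr_gt0.
- by apply: Hyp_total; lia.
Qed.

(** Provides the decay of n D n for the variance. Two of the laws have finite support; for
    Poi(lambda) and NB(r + 1, p), k times the mass at k is a constant times the mass at k - 1 of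
    Poi(lambda) or NB(r + 2, p), a term of a convergent series. *)
Lemma law_down_moment0 L : admissible L ->
  (fun k : nat => k%:R * law_pmf (law_down L) k) @ \oo --> (0 : R).
Proof.
case: L => [N p _|lambda l0|r p [r0 p01]|N K n _].
- apply: cvg_natr_finite => k; exact: law_pmf_Bin_eq0.
- rewrite -[X in _ --> X](mulr0 lambda) -cvg_shiftS.
  rewrite (funext (fun k => @mul_Poi_pmfS lambda k l0)); apply: cvgMr.
  by have /cvgP/cvg_series_cvg_0 := Poi_total l0.
- have p0 : 0 < p by case/andP: p01.
  rewrite -[X in _ --> X](mulr0 ((r + 1) * (1 - p) / p)) -cvg_shiftS.
  rewrite (funext (fun k => mul_NB_pmfS (r + 1) k p0)); apply: cvgMr.
  have r2 : 0 < r + 1 + 1 by rewrite !addr_gt0.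
  by have /cvgP/cvg_series_cvg_0 := NB_total r2 p01.
- apply: cvg_natr_finite => k; exact: law_pmf_Hyp_eq0.
Qed.

Lemma law_mean_gt0 L : admissible L -> 0 < law_mean L.
Proof.
case: L => [N p [N1 /andP[p0 _]]|lambda|r p [r0 /andP[p0 p1]]
           |N K n [/andP[K1 KN] /andP[n1 nN]]] //=.
- by rewrite mulr_gt0// ltr0n.
- by rewrite divr_gt0// mulr_gt0// subr_gt0.
- by rewrite divr_gt0 ?mulr_gt0 ?ltr0n//; lia.
Qed.

End Laws.

(** Positivity of mu makes its ceiling a natural number, the index at which [cvg_series_mad] splits
    the sum. *)
Lemma ceil_natP (R : realType) (mu : R) : 0 < mu ->
  exists m : nat, [/\ Num.ceil mu = m%:Z,
    forall k, (k < m)%N -> k%:R <= mu & forall k, (m <= k)%N -> mu <= k%:R].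
Proof.
move=> mu0; have : 0 < Num.ceil mu by rewrite ceil_gt0.
case E : (Num.ceil mu) => [m|//] _; exists m; split=> // k.
  by rewrite -ltz_nat -E ceil_gt_int => /ltW.
by move=> mk; rewrite (le_trans (ceil_ge mu))// E ler_nat.
Qed.

Theorem theorem3p3 (R : realType) (d : measure_display) (T : measurableType d)
    (P : probability T R) (X : {RV P >-> R}) (L : law R)
    (hL : admissible L) (hX : has_law X L) :
  let mu := law_mean L in
  let sigma2 := law_var L in
  let nu : int := Num.ceil mu in
  [/\ 'E_P[X]%E = mu%:E,
      'V_P[X]%E = sigma2%:E &
      'E_P[(fun w => `|X w - mu|%R)]%E
        = (2 * sigma2 * law_pmf (law_down L) (nu - 1))%:E].
Proof.
move=> mu sigma2 nu.
have pX (k : nat) : pmf X k%:R = law_pmf L k by rewrite -hX.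
pose D := law_down_shift L; pose p (k : nat) := law_pmf L k.
have pmfE : (fun k : nat => pmf X k%:R) = p by exact: funext.
have stein k : (k%:R - mu) * p k = sigma2 * (D k - D k.+1) by exact: law_stein.
have D0 : D 0 = 0 by [].
have DS k : D k.+1 = law_pmf (law_down L) k by exact: law_down_shiftS.
have down0 : (fun k : nat => law_pmf (law_down L) k) @ \oo --> (0 : R).
  by have /cvgP/cvg_series_cvg_0 := law_down_total hL.
have Dc : D @ \oo --> (0 : R).
  by rewrite -cvg_shiftS (funext DS).
have D1 : series D @ \oo --> (1 : R).
  rewrite -cvg_shiftS (_ : [sequence _]_n = series (fun k : nat => law_pmf (law_down L) k)).
    exact: law_down_total.
  apply/funext => n; rewrite seriesEnat /= big_nat_recl// D0 add0r.
  by apply: eq_bigr => k _; exact: law_down_shiftS.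
(* After an index shift, (n + 1) D (n + 1) is the first-moment term of the shifted law at n plus its
   mass at n. *)
have nD : (fun n => n%:R * D n) @ \oo --> (0 : R).
  rewrite -[X in _ --> X](addr0 0) -cvg_shiftS.
  rewrite (_ : [sequence _]_n = (fun k : nat => k%:R * law_pmf (law_down L) k
    + law_pmf (law_down L) k)); last first.
    by apply/funext => k; rewrite -DS -[X in _ + X]mul1r -mulrDl natr1.
  apply: cvgD => //.
  exact: law_down_moment0.
have pmf1 : series (fun k => pmf X k%:R) @ \oo --> (1 : R).
  by rewrite pmfE; exact: law_total.
have series_pX (f : R -> R) : series (fun k => f k%:R * pmf X k%:R)
    = series (fun k => f k%:R * p k).
  by congr series; apply/funext => k; rewrite pX.
have EX : 'E_P[X]%E = mu%:E.
  apply: expectation_nat_supported_id => //.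
  rewrite (series_pX id); apply: (cvg_series_mean stein) => //.
  by rewrite -pmfE.
split=> //.
- rewrite /variance unlock EX /=.
  apply: (@expectation_nat_supported _ _ _ _ X pmf1 (fun x => (x - mu) * (x - mu))).
  + by apply: measurable_funM; apply: measurable_funB.
  + by move=> x; rewrite -expr2 sqr_ge0.
  + rewrite (series_pX (fun x => (x - mu) * (x - mu))).
    exact: (cvg_series_variance stein).
- have [m [mE ltm gem]] := ceil_natP (law_mean_gt0 hL).
  (* The mass at [m%:Z - 1] is [D m] by definition of [law_down_shift]. *)
  rewrite /nu mE.
  apply: (@expectation_nat_supported _ _ _ _ X pmf1 (fun x => `|x - mu|)) => //.
  + by apply: measurableT_comp => //; exact: measurable_funB.
  + rewrite (series_pX (fun x => `|x - mu|)).
    exact: (cvg_series_mad stein).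
Qed.
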